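(* Let $k$ be an algebraically closed field of characteristic $0$, let $n$ be a positive integer, and let $k((X_1,\ldots,X_n))$ denote the quotient field of the formal power series ring $k[[X_1,\ldots,X_n]]$. Let $m$ be a fixed integer with $1\le m\le n-1$. Then there exists a rank-one discrete valuation of $k((X_1,\ldots,X_n))$ of dimension $m$.
   Context: Write $R_n=k[[X_1,\ldots,X_n]]$, $M_n=(X_1,\ldots,X_n)$ for its maximal ideal, and $K_n=k((X_1,\ldots,X_n))$ for the quotient field of $R_n$. For a valuation $v$ of $K_n\vert k$ (i.e. a valuation of $K_n$ trivial on $k$), $R_v$ denotes its valuation ring, $\mathfrak{m}_v$ the maximal ideal of $R_v$, and $\Delta_v=R_v/\mathfrak{m}_v$ its residue field. The center of $v$ in $R_n$ is $\mathfrak{m}_v\cap R_n$. Convention: ''rank-one discrete valuation of $k((X_1,\ldots,X_n))$'' means a rank-one discrete valuation $v$ of $K_n\vert k$ with value group $\mathbb{Z}$ whose center in $R_n$ is the maximal ideal $M_n$ (in particular $R_n\subset R_v$). The dimension of $v$ is the transcendence degree of $\Delta_v$ over $k$. *)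

(* Defs.v *)
From HB Require Import structures.
From mathcomp Require Import all_boot all_order all_algebra.
From mathcomp Require Import boolp.
From mathcomp Require Import mpoly.

Set Implicit Arguments.
Unset Strict Implicit.
Unset Printing Implicit Defensive.

Import Order.TTheory GRing.Theory Num.Theory.
Import Quotient.Exports.
Local Open Scope ring_scope.
Local Open Scope quotient_scope.

Record fps (n : nat) (R : Type) := FPS { fps_coef : 'X_{1..n} -> R }.

Notation "{ 'fps' R [ n ] }" := (fps n R)
  (at level 0, R at level 2, n at level 2, format "{ 'fps'  R [ n ] }").

HB.instance Definition _ n (R : Type) := [isNew for @fps_coef n R].
HB.instance Definition _ n (R : Type) := gen_eqMixin {fps R[n]}.
HB.instance Definition _ n (R : Type) := gen_choiceMixin {fps R[n]}.

Section FPSRing.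
Variables (n : nat) (R : comNzRingType).
Implicit Types (f g h : {fps R[n]}) (m : 'X_{1..n}).

Lemma fpsP f g : (forall m, fps_coef f m = fps_coef g m) <-> f = g.
Proof.
split=> [|-> //]; case: f g => [f] [g] /= fg.
by congr FPS; apply: funext.
Qed.

Definition fps_zero : {fps R[n]} := FPS (fun=> 0).
Definition fps_opp f := FPS (fun m => - fps_coef f m).
Definition fps_add f g := FPS (fun m => fps_coef f m + fps_coef g m).

(* The bounds on [k] only make the range finite: every pair of multinomials
   with sum [m] satisfies them. *)
Definition fps_mul f g := FPS (fun m =>
  \sum_(k : 'X_{1..n < (mdeg m).+1, (mdeg m).+1} | m == (k.1 + k.2)%MM)
     fps_coef f k.1 * fps_coef g k.2).

Definition fpsC (c : R) : {fps R[n]} :=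
  FPS (fun m => c *+ (m == 0%MM)).

Definition fpsX (i : 'I_n) : {fps R[n]} :=
  FPS (fun m => (m == U_(i)%MM)%:R).

Lemma fps_addA : associative fps_add.
Proof. by move=> f g h; apply/fpsP => m /=; rewrite addrA. Qed.
Lemma fps_addC : commutative fps_add.
Proof. by move=> f g; apply/fpsP => m /=; rewrite addrC. Qed.
Lemma fps_add0 : left_id fps_zero fps_add.
Proof. by move=> f; apply/fpsP => m /=; rewrite add0r. Qed.
Lemma fps_addN : left_inverse fps_zero fps_opp fps_add.
Proof. by move=> f; apply/fpsP => m /=; rewrite addNr. Qed.

HB.instance Definition _ :=
  GRing.isZmodule.Build {fps R[n]} fps_addA fps_addC fps_add0 fps_addN.

Lemma fps_coefD f g m : fps_coef (f + g) m = fps_coef f m + fps_coef g m.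
Proof. by []. Qed.

Definition fps_trunc (d : nat) f : {mpoly R[n]} :=
  \sum_(m : 'X_{1..n < d}) fps_coef f m *: 'X_[m].

Lemma mcoeff_trunc d f m :
  (fps_trunc d f)@_m = if (mdeg m < d)%N then fps_coef f m else 0.
Proof.
rewrite /fps_trunc raddf_sum /=; case: ifP => [lt_md|ge_md].
  rewrite (bigD1 (BMultinom lt_md)) //= mcoeffZ mcoeffX eqxx mulr1.
  rewrite big1 ?addr0 // => i; rewrite bmeqP /= => /negPf ne.
  by rewrite mcoeffZ mcoeffX ne mulr0.
rewrite big1 // => i _; rewrite mcoeffZ mcoeffX.
by case: eqP => [e|]; rewrite ?mulr0 //; rewrite -e bmdeg in ge_md.
Qed.

Lemma fps_coef_trunc d f m :
  (mdeg m < d)%N -> fps_coef f m = (fps_trunc d f)@_m.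
Proof. by rewrite mcoeff_trunc => ->. Qed.

Lemma mcoeffM_low (p p' q q' : {mpoly R[n]}) m :
    (forall m', (mdeg m' <= mdeg m)%N -> p@_m' = p'@_m') ->
    (forall m', (mdeg m' <= mdeg m)%N -> q@_m' = q'@_m') ->
  (p * q)@_m = (p' * q')@_m.
Proof.
move=> ep eq; rewrite !mcoeffM; apply: eq_bigr => -[k1 k2] /= /eqP.
move=> /(congr1 mdeg); rewrite mdegD => e.
by congr (_ * _); [apply: ep | apply: eq]; rewrite [leqRHS]e ?leq_addr ?leq_addl.
Qed.

Lemma fps_coefM d f g m : (mdeg m < d)%N ->
  fps_coef (fps_mul f g) m = (fps_trunc d f * fps_trunc d g)@_m.
Proof.
move=> lt_md; rewrite mcoeffM /=; apply: eq_bigr => -[k1 k2] /= /eqP.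
move=> /(congr1 mdeg); rewrite mdegD => e.
by rewrite -!fps_coef_trunc // (leq_ltn_trans _ lt_md) // [leqRHS]e
  ?leq_addl ?leq_addr.
Qed.

Lemma fps_truncM d f g m : (mdeg m < d)%N ->
  (fps_trunc d (fps_mul f g))@_m = (fps_trunc d f * fps_trunc d g)@_m.
Proof. by move=> lt_md; rewrite -fps_coef_trunc // (fps_coefM _ _ lt_md). Qed.

Lemma fps_trunc1 d : fps_trunc d.+1 (fpsC 1) = 1.
Proof.
apply/mpolyP => m; rewrite mcoeff_trunc mcoeff1 /=.
by have [->|_] := eqVneq m 0%MM; rewrite ?mdeg0 //=; case: ifP.
Qed.

Lemma fps_truncD d f g : fps_trunc d (f + g) = fps_trunc d f + fps_trunc d g.
Proof.
apply/mpolyP => m; rewrite mcoeffD !mcoeff_trunc.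
by case: ifP => // _; rewrite addr0.
Qed.

Lemma fps_mulA : associative fps_mul.
Proof.
move=> f g h; apply/fpsP => m.
rewrite !(fps_coefM _ _ (ltnSn (mdeg m))).
set d := (mdeg m).+1.
rewrite (@mcoeffM_low _ (fps_trunc d f) _ (fps_trunc d g * fps_trunc d h)) //.
  rewrite mulrA; apply: mcoeffM_low => // m' le_m'.
  by rewrite fps_truncM.
by move=> m' le_m'; rewrite fps_truncM.
Qed.

Lemma fps_mulC : commutative fps_mul.
Proof.
move=> f g; apply/fpsP => m.
by rewrite !(fps_coefM _ _ (ltnSn (mdeg m))) mulrC.
Qed.

Lemma fps_mul1 : left_id (fpsC 1) fps_mul.
Proof.
move=> f; apply/fpsP => m; rewrite (fps_coefM _ _ (ltnSn (mdeg m))).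
by rewrite fps_trunc1 mul1r -fps_coef_trunc.
Qed.

Lemma fps_mulDl : left_distributive fps_mul +%R.
Proof.
move=> f g h; apply/fpsP => m.
by rewrite fps_coefD !(fps_coefM _ _ (ltnSn (mdeg m))) fps_truncD mulrDl mcoeffD.
Qed.

Lemma fps_one_neq0 : fpsC 1 != 0.
Proof.
apply/eqP => /fpsP /(_ 0%MM) /=; rewrite eqxx => /eqP.
by rewrite oner_eq0.
Qed.

HB.instance Definition _ := GRing.Zmodule_isComNzRing.Build {fps R[n]}
  fps_mulA fps_mulC fps_mul1 fps_mulDl fps_one_neq0.

Lemma fpsC_is_zmod_morphism : zmod_morphism fpsC.
Proof. by move=> a b; apply/fpsP => m /=; rewrite mulrnBl. Qed.

Lemma fpsC_is_monoid_morphism : monoid_morphism fpsC.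
Proof.
split=> // a b; apply/fpsP => m; rewrite (fps_coefM _ _ (ltnSn (mdeg m))).
have truncC c : fps_trunc (mdeg m).+1 (fpsC c) = c%:MP.
  apply/mpolyP => m'; rewrite mcoeff_trunc mcoeffC /=.
  have [->|_] := eqVneq m' 0%MM; rewrite ?mdeg0 ?mulr1 ?mulr0 //=.
  by case: ifP.
by rewrite !truncC -mpolyCM mcoeffC /= mulr_natr.
Qed.

HB.instance Definition _ :=
  GRing.isZmodMorphism.Build R {fps R[n]} fpsC fpsC_is_zmod_morphism.
HB.instance Definition _ :=
  GRing.isMonoidMorphism.Build R {fps R[n]} fpsC fpsC_is_monoid_morphism.

Definition fps_unit : pred {fps R[n]} := fun f => `[< exists g, g * f = 1 >].

Definition fps_inv f : {fps R[n]} :=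
  if pselect (exists g, g * f = 1) is left gP then projT1 (cid gP) else f.

Lemma fps_mulVr : {in fps_unit, left_inverse 1 fps_inv *%R}.
Proof.
move=> f /asboolP gP; rewrite /fps_inv; case: pselect => // gP'.
by case: cid.
Qed.

Lemma fps_unitPl f g : g * f = 1 -> fps_unit f.
Proof. by move=> gf; apply/asboolP; exists g. Qed.

Lemma fps_inv_out : {in [predC fps_unit], fps_inv =1 id}.
Proof.
move=> f /negP nu; rewrite /fps_inv; case: pselect => // gP.
by case: nu; apply/asboolP.
Qed.

HB.instance Definition _ := GRing.ComNzRing_hasMulInverse.Build {fps R[n]}
  fps_mulVr fps_unitPl fps_inv_out.

End FPSRing.

Section FPSDomain.
Variables (n : nat) (R : idomainType).
Implicit Types f g : {fps R[n]}.

Lemma fps_lowest f : f != 0 -> exists m,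
  fps_coef f m != 0 /\ forall m', (m' < m)%O -> fps_coef f m' = 0.
Proof.
move=> nz_f.
have [[m fm]|noP] := pselect (exists m, fps_coef f m != 0); last first.
  case/eqP: nz_f; apply/fpsP => m; apply/eqP/negPn/negP => fm.
  by apply: noP; exists m.
move: m fm; apply: ltmwf => m IH fm.
have [[m' [lt_m' fm']]|noP] :=
    pselect (exists m', (m' < m)%O /\ fps_coef f m' != 0).
  exact: IH lt_m' fm'.
exists m; split=> // m' lt_m'; apply/eqP/negPn/negP => fm'.
by apply: noP; exists m'.
Qed.

Lemma fps_idomain : GRing.integral_domain_axiom {fps R[n]}.
Proof.
move=> f g fg0; apply/norP => -[/fps_lowest [m1 [f1 lo1]]].
move=> /fps_lowest [m2 [g2 lo2]].
set m := (m1 + m2)%MM.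
have lt1 : (mdeg m1 < (mdeg m).+1)%N by rewrite ltnS mdegD leq_addr.
have lt2 : (mdeg m2 < (mdeg m).+1)%N by rewrite ltnS mdegD leq_addl.
have /eqP : fps_coef (f * g) m = 0 by rewrite fg0.
rewrite /= (bigD1 (BMultinom lt1, BMultinom lt2)) //= big1 ?addr0.
  by rewrite mulf_eq0 (negPf f1) (negPf g2).
case=> k1 k2 /= /andP[/eqP e ne].
have [lt_k1|gt_k1|e1] := ltgtP (k1 : 'X_{1..n}) m1.
- by rewrite lo1 ?mul0r.
- rewrite [X in _ * X]lo2 ?mulr0 // ltNge; apply/negP => le_m2.
  by have := ltmc_le_add gt_k1 le_m2; rewrite -e ltxx.
- case/eqP: ne; congr pair; apply/val_inj => //=.
  by apply: (@addmI _ m1); rewrite -{1}e1 -e.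
Qed.

HB.instance Definition _ :=
  GRing.ComUnitRing_isIntegral.Build {fps R[n]} fps_idomain.

End FPSDomain.

Definition fps_maxideal (n : nat) (k : fieldType) (f : {fps k[n]}) : Prop :=
  exists g : 'I_n -> {fps k[n]}, f = \sum_(i < n) g i * fpsX k i.

Definition fps_frac_inj n (k : fieldType) :
    {rmorphism k -> {fraction {fps k[n]}}} :=
  @tofrac {fps k[n]} \o @fpsC n k.

(* Rank-one discrete valuation of K|k with value group exactly Z. The value
   at 0, conventionally +oo, is left unspecified; no definition below looks
   at it. *)
Record dvaluation (k K : fieldType) (iota : {rmorphism k -> K}) := DValuation {
  dval :> K -> int;
  dvalM : forall x y, x != 0 -> y != 0 -> dval (x * y) = dval x + dval y;
  dvalD : forall x y, x != 0 -> y != 0 -> x + y != 0 ->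
    Num.min (dval x) (dval y) <= dval (x + y);
  dval_surj : forall z : int, exists2 x, x != 0 & dval x = z;
  dval_triv : forall c, c != 0 -> dval (iota c) = 0
}.

Section Valuation.
Variables (k K : fieldType) (iota : {rmorphism k -> K}) (v : dvaluation iota).

Definition in_vring : pred K := fun x => (x == 0) || (0 <= v x).
Definition in_vmax : pred K := fun x => (x == 0) || (0 < v x).

Lemma dval1 : v 1 = 0.
Proof.
have := dvalM v (oner_neq0 K) (oner_neq0 K); rewrite mulr1.
by move/eqP; rewrite -subr_eq0 opprD addrA subrr add0r oppr_eq0 => /eqP.
Qed.

Lemma dvalV x : x != 0 -> v x^-1 = - v x.
Proof.
move=> nz; apply/eqP; rewrite eq_sym -subr_eq0 -opprD oppr_eq0 -dvalM ?invr_eq0 //.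
by rewrite mulfV // dval1.
Qed.

Lemma dvalN x : v (- x) = v x.
Proof.
have [->|nz] := eqVneq x 0; first by rewrite oppr0.
have nzN1 : (-1 : K) != 0 by rewrite oppr_eq0 oner_neq0.
rewrite -mulN1r dvalM //.
suff -> : v (-1) = 0 by rewrite add0r.
have := dvalM v nzN1 nzN1; rewrite mulrNN mulr1 dval1.
by move/esym/eqP; rewrite -mulr2n mulrn_eq0 /= => /eqP.
Qed.

Lemma in_vringB x y : in_vring x -> in_vring y -> in_vring (x - y).
Proof.
have [->|nx] := eqVneq x 0; first by rewrite /in_vring sub0r oppr_eq0 dvalN.
have [->|ny] := eqVneq y 0; first by rewrite subr0.
rewrite /in_vring (negPf nx) (negPf ny) /= => vx vy.
have [//|nxy] := eqVneq (x - y) 0.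
apply: le_trans (dvalD v nx _ nxy); rewrite ?oppr_eq0 //.
by rewrite le_min vx dvalN.
Qed.

Lemma in_vringM x y : in_vring x -> in_vring y -> in_vring (x * y).
Proof.
rewrite /in_vring mulf_eq0.
have [//|nx /=] := eqVneq x 0; have [//|ny /=] := eqVneq y 0.
by rewrite dvalM //; apply: addr_ge0.
Qed.

Lemma in_vring_closed : subring_closed in_vring.
Proof.
split; [|exact: in_vringB|exact: in_vringM].
by rewrite /in_mem /= /in_vring dval1 lexx orbT.
Qed.

HB.instance Definition _ :=
  GRing.isSubringClosed.Build K in_vring in_vring_closed.

Record vring := VRing { vring_val :> K; _ : vring_val \in in_vring }.

HB.instance Definition _ := [isSub for vring_val].
HB.instance Definition _ := [Choice of vring by <:].
HB.instance Definition _ := [SubChoice_isSubComNzRing of vring by <:].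

Lemma vring_val0 : vring_val 0 = 0. Proof. exact: (rmorph0 val). Qed.
Lemma vring_val1 : vring_val 1 = 1. Proof. exact: (rmorph1 val). Qed.
Lemma vring_valD x y : vring_val (x + y) = vring_val x + vring_val y.
Proof. exact: (rmorphD val). Qed.
Lemma vring_valM x y : vring_val (x * y) = vring_val x * vring_val y.
Proof. exact: (rmorphM val). Qed.

Definition vmax : pred vring := fun x => in_vmax (vring_val x).

Lemma vmax_ideal : idealr_closed vmax.
Proof.
split.
- by rewrite /in_mem /= /vmax /in_vmax vring_val0 eqxx.
- by rewrite /in_mem /= /vmax /in_vmax vring_val1 oner_eq0 dval1 ltxx.
move=> a x y; rewrite /in_mem /= /vmax vring_valD vring_valM.
case: a x y => [a Ha] [x Hx] [y Hy] /=.
have {}Ha : in_vring a by [].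
have mM : in_vmax x -> in_vmax (a * x).
  move: Ha; rewrite /in_vring /in_vmax mulf_eq0.
  have [//|na /=] := eqVneq a 0; have [//|nx /=] := eqVneq x 0.
  by move=> va vx; rewrite dvalM // ltr_wpDl.
move=> /mM; move: (a * x) => {mM Ha Hx a x} x.
have [->|nx] := eqVneq x 0; first by rewrite add0r.
have [->|ny] := eqVneq y 0; first by rewrite addr0.
rewrite /in_vmax (negPf nx) (negPf ny) /= => vx vy.
have [//|nxy] := eqVneq (x + y) 0.
by apply: lt_le_trans (dvalD v nx ny nxy); rewrite lt_min vx.
Qed.

HB.instance Definition _ := isIdealr.Build vring vmax vmax_ideal.

Definition vresidue := {ideal_quot (vmax : idealr vring)}.
HB.instance Definition _ := GRing.ComNzRing.on vresidue.

(* Only meaningful on units: the default 0 is taken on the maximal ideal. *)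
Definition vring_inv (x : vring) : vring := insubd 0 (val x)^-1.

Definition vresidue_inv (x : vresidue) : vresidue :=
  \pi_vresidue (vring_inv (repr x)).

Lemma pi_vresidue_eq0 (x : vring) : (\pi_vresidue x == 0) = in_vmax (val x).
Proof.
rewrite -(rmorph0 (\pi_vresidue)).
by rewrite -Quotient.idealrBE subr0.
Qed.

Lemma vresidue_mulV (x : vresidue) : x != 0 -> vresidue_inv x * x = 1.
Proof.
rewrite -{1 3}[x]reprK pi_vresidue_eq0 /vresidue_inv /vring_inv.
case: (repr x) => y Hy /=; rewrite /in_vmax negb_or -leNgt => /andP[ny vy].
have vy0 : v y = 0.
  by apply/eqP; rewrite eq_le vy /=; move: Hy; rewrite unfold_in /in_vring (negPf ny).
have Hi : y^-1 \in in_vring by rewrite unfold_in /in_vring dvalV // vy0 oppr0 lexx orbT.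
rewrite -rmorphM -[RHS](rmorph1 (\pi_vresidue)); congr (\pi_vresidue _).
by apply: val_inj => /=; rewrite -[vring_val _]/(val _) insubdK // mulVf.
Qed.

Lemma vresidue_inv0 : vresidue_inv 0 = 0.
Proof.
apply/eqP; rewrite /vresidue_inv pi_vresidue_eq0 /vring_inv.
have : in_vmax (val (repr (0 : vresidue))) by rewrite -pi_vresidue_eq0 reprK.
case: (repr (0 : vresidue)) => y Hy /= my.
rewrite val_insubd; case: ifP => [|_]; last by rewrite rmorph0 /in_vmax eqxx.
rewrite unfold_in /in_vring /in_vmax invr_eq0; case: eqVneq => //= ny.
rewrite dvalV // oppr_ge0 leNgt.
by move: my; rewrite /in_vmax (negPf ny) /= => ->.
Qed.

HB.instance Definition _ :=
  GRing.ComNzRing_isField.Build vresidue vresidue_mulV vresidue_inv0.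

Lemma in_vring_const c : iota c \in in_vring.
Proof.
rewrite unfold_in /in_vring fmorph_eq0; case: eqVneq => //= nc.
by rewrite dval_triv.
Qed.

Definition vring_const (c : k) : vring := VRing (in_vring_const c).

Lemma vring_const_is_zmod_morphism : zmod_morphism vring_const.
Proof. by move=> a b; apply: val_inj; rewrite /= rmorphB. Qed.

Lemma vring_const_is_monoid_morphism : monoid_morphism vring_const.
Proof.
split; first by apply: val_inj; rewrite /= rmorph1.
by move=> a b; apply: val_inj; rewrite /= rmorphM.
Qed.

HB.instance Definition _ :=
  GRing.isZmodMorphism.Build k vring vring_const vring_const_is_zmod_morphism.
HB.instance Definition _ :=
  GRing.isMonoidMorphism.Build k vring vring_const vring_const_is_monoid_morphism.

Definition vresidue_const : {rmorphism k -> vresidue} :=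
  \pi_vresidue \o vring_const.

End Valuation.

Section Trdeg.
Variables (F E : fieldType) (iota : {rmorphism F -> E}).

Definition alg_independent (m : nat) (t : 'I_m -> E) : Prop :=
  forall p : {mpoly F[m]}, mmap iota t p = 0 -> p = 0.

(* x lies in F(t), the field generated over F by the family t. *)
Definition gen_subfield (m : nat) (t : 'I_m -> E) (x : E) : Prop :=
  exists p q : {mpoly F[m]},
    mmap iota t q != 0 /\ x = mmap iota t p / mmap iota t q.

Definition algebraic_over_gen (m : nat) (t : 'I_m -> E) (x : E) : Prop :=
  exists p : {poly E},
    [/\ p != 0, forall i, gen_subfield t p`_i & root p x].

Definition transcendence_basis (m : nat) (t : 'I_m -> E) : Prop :=
  alg_independent t /\ forall x, algebraic_over_gen t x.

(* The transcendence degree of E over F is finite and equal to m. *)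
Definition has_trdeg (m : nat) : Prop :=
  exists t : 'I_m -> E, transcendence_basis t.

End Trdeg.

Definition has_dimension (k K : fieldType) (iota : {rmorphism k -> K})
    (v : dvaluation iota) (m : nat) : Prop :=
  has_trdeg (vresidue_const v) m.

Definition centered_at_maxideal (n : nat) (k : fieldType)
    (v : dvaluation (fps_frac_inj n k)) : Prop :=
  (forall f : {fps k[n]}, in_vring v (tofrac f)) /\
  (forall f : {fps k[n]}, in_vmax v (tofrac f) <-> fps_maxideal f).

(* Main.v *)
Require Import Defs.
From mathcomp Require Import all_boot all_order all_algebra.
From HB Require Import structures.
From mathcomp Require Import boolp ring mpoly.

Set Implicit Arguments.
Unset Strict Implicit.
Unset Printing Implicit Defensive.

Import Order.TTheory GRing.Theory Num.Theory.
Import Quotient.Exports.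
Local Open Scope ring_scope.
Local Open Scope quotient_scope.

(** The valuation is the order in [t] pulled back along an injective
substitution of power series. Let [A = k[u_0, ..., u_(m-1)]] and send [X_i] to
a series [x_i] in [t A[[t]]] whose terms of degree one are [t] for [i = 0],
[u_(i-1) t] for [1 <= i <= m] and [0] for the other [i]. Substitution is a ring
morphism [phi : k[[X]] -> A[[t]]]. If it is injective, [ord_t (phi f)] extends
to a discrete valuation of the fraction field, positive exactly on the maximal
ideal. Reading off the leading coefficient of [phi f] over that of [phi g]
gives a morphism from the valuation ring to [Frac A], with kernel the maximal
ideal, that maps [X_i / X_0] to [u_(i-1)]; so the residue field is
[k(u_0, ..., u_(m-1))], of transcendence degree [m]
([has_dimension_residue_map]).

Injectivity is arranged by the higher terms of the [x_i]: the coefficient of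
[t^j], for [j >= 2], is nonzero in exactly one of the [x_i], the one with
[i = j mod n], and there it is [u_0 ^ (2j)!]. Then the kernel of [phi] is
closed under every partial derivative ([fps_subst_deriv_eq0]). For suppose that
[phi f = 0], and let [r] be the least order of the [phi (d_i f)], attained at
[i]. Choose [J > r] in the residue class of [i] and compare coefficients of
[t^(r+J)] in the first-order Taylor expansion of [f] at the [x_i] truncated
below [J] ([mmap_taylor1]). The linear term contributes [x_(i,J)] times the
nonzero leading coefficient of [phi (d_i f)], whose degree in [u] is at least
[(2J)!]; the value at the truncations has a much smaller degree, and all other
terms vanish. So the sum cannot be zero.

In characteristic zero, differentiating a nonzero series along a monomial that
occurs in it yields a series with a nonzero constant coefficient, and such a
series is not in the kernel. Hence the kernel is zero ([fps_subst_inj]). *)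

(** * Lowest terms of Cauchy products *)

Section CauchyProduct.
Variables (A : pzSemiRingType) (u w : nat -> A) (a b : nat).
Hypothesis u_low : forall i, (i < a)%N -> u i = 0.
Hypothesis w_low : forall i, (i < b)%N -> w i = 0.

Lemma cauchy_prod_lt N : (N < a + b)%N -> \sum_(i < N.+1) u i * w (N - i)%N = 0.
Proof.
move=> ltN; rewrite big1 // => i _.
have [/u_low ->|le_a] := ltnP i a; first by rewrite mul0r.
by rewrite w_low ?mulr0 // ltn_subLR ?(leq_trans ltN) ?leq_add2r // -ltnS.
Qed.

Lemma cauchy_prod_low :
  \sum_(i < (a + b).+1) u i * w (a + b - i)%N = u a * w b.
Proof.
have lt_a : (a < (a + b).+1)%N by rewrite ltnS leq_addr.
rewrite (bigD1 (Ordinal lt_a)) //= addKn big1 ?addr0 // => i ne_i.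
have [/u_low ->|gt_a|eq_a] := ltngtP i a; first by rewrite mul0r.
  by rewrite w_low ?mulr0 // ltn_subLR ?ltn_add2r // -ltnS.
by case/eqP: ne_i; apply: val_inj.
Qed.

End CauchyProduct.

(** * The valuation given by the order of a series *)

(** [c f N] stands for the coefficient of [t^N] in the image of [f] under an
injective ring morphism from [D] to [A[[t]]]; only the additivity of [c], the
Cauchy product formula, injectivity and the behaviour on constants are used.
The map [jD] embeds the constants in [D], and [iota] in its fraction field. *)
Section SeriesValuation.
Variables (k : fieldType) (D A : idomainType) (jD : k -> D).
Variables (iota : {rmorphism k -> {fraction D}}) (c : D -> nat -> A).
Hypothesis iotaE : forall a, iota a = tofrac (jD a).
Hypothesis cD : forall f g N, c (f + g) N = c f N + c g N.
Hypothesis cM : forall f g N, c (f * g) N = \sum_(i < N.+1) c f i * c g (N - i).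
Hypothesis c_inj : forall f, f != 0 -> exists N, c f N != 0.
Hypothesis c_const : forall a, a != 0 -> c (jD a) 0 != 0.

Local Notation "x %:F" := (tofrac x).

Lemma ser0 N : c 0 N = 0.
Proof. by have /eqP := cD 0 0 N; rewrite addr0 -subr_eq subrr eq_sym => /eqP. Qed.

(** The order of the image series; it is [0] on [f = 0]. *)
Definition ser_ord (f : D) : nat :=
  if pselect (exists N, c f N != 0) is left exN then ex_minn exN else 0%N.

Lemma ser_ord_neq0 f : f != 0 -> c f (ser_ord f) != 0.
Proof.
move=> /c_inj exN; rewrite /ser_ord; case: pselect => // exN'.
by case: ex_minnP.
Qed.

Lemma ser_ord_lt f N : (N < ser_ord f)%N -> c f N = 0.
Proof.
rewrite /ser_ord; case: pselect => // exN; case: ex_minnP => n _ min_n.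
by apply: contraTeq => /min_n; rewrite -leqNgt.
Qed.

Lemma ser_ord_le f N : c f N != 0 -> (ser_ord f <= N)%N.
Proof. by apply: contraNT; rewrite -ltnNge => /ser_ord_lt ->. Qed.

Lemma ser_ord_ge f a : f != 0 -> (forall i, (i < a)%N -> c f i = 0) ->
  (a <= ser_ord f)%N.
Proof.
move=> /ser_ord_neq0 nz lo; rewrite leqNgt; apply: contraNN nz => /lo ->.
exact: eqxx.
Qed.

Lemma ser_ord_eq f N : c f N != 0 -> (forall i, (i < N)%N -> c f i = 0) ->
  ser_ord f = N.
Proof.
move=> nz lo; apply/eqP; rewrite eqn_leq ser_ord_le //= ser_ord_ge //.
by apply: contraNneq nz => ->; rewrite ser0.
Qed.

Lemma ser_coefM_lt f g a b N :
    (forall i, (i < a)%N -> c f i = 0) -> (forall i, (i < b)%N -> c g i = 0) ->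
  (N < a + b)%N -> c (f * g) N = 0.
Proof. by move=> fa gb ltN; rewrite cM (cauchy_prod_lt fa gb). Qed.

Lemma ser_coefM_low f g a b :
    (forall i, (i < a)%N -> c f i = 0) -> (forall i, (i < b)%N -> c g i = 0) ->
  c (f * g) (a + b) = c f a * c g b.
Proof. by move=> fa gb; rewrite cM (cauchy_prod_low fa gb). Qed.

Lemma ser_ordM f g : f != 0 -> g != 0 ->
  ser_ord (f * g) = (ser_ord f + ser_ord g)%N.
Proof.
move=> nf ng; apply/eqP; rewrite eqn_leq; apply/andP; split.
  apply: ser_ord_le; rewrite ser_coefM_low; try exact: ser_ord_lt.
  by rewrite mulf_neq0 ?ser_ord_neq0.
apply: ser_ord_ge => [|i lt_i]; first by rewrite mulf_neq0.
by apply: ser_coefM_lt lt_i; apply: ser_ord_lt.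
Qed.

Lemma ser_ord1 : ser_ord 1 = 0%N.
Proof.
have := ser_ordM (oner_neq0 D) (oner_neq0 D); rewrite mulr1 => /eqP.
by rewrite -{1}[ser_ord 1]addn0 eqn_add2l eq_sym => /eqP.
Qed.

Lemma ser_ordD f g : f + g != 0 ->
  (minn (ser_ord f) (ser_ord g) <= ser_ord (f + g))%N.
Proof.
move=> nfg; apply: ser_ord_ge => // i; rewrite leq_min => /andP[lf lg].
by rewrite cD !ser_ord_lt ?addr0.
Qed.

Lemma fraction_quot (x : {fraction D}) :
  exists fg : D * D, fg.2 != 0 /\ x = fg.1%:F / fg.2%:F.
Proof.
elim/quotW: x => r; exists (frac r); split; first exact: denom_ratioP.
have nd := denom_ratioP r.
apply: (canRL (mulfK _)); first by rewrite tofrac_eq0.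
unlock FracField.tofrac; rewrite -[LHS]FracField.pi_mul; apply/eqmodP.
rewrite /= FracField.equivfE /FracField.mulf.
by rewrite !numden_Ratio ?mulr1 ?oner_neq0 // mulrC.
Qed.

(** A chosen numerator and denominator of [x]. *)
Definition fnum (x : {fraction D}) : D := (projT1 (cid (fraction_quot x))).1.
Definition fden (x : {fraction D}) : D := (projT1 (cid (fraction_quot x))).2.

Lemma fden_neq0 x : fden x != 0.
Proof. by rewrite /fden; case: cid => ? []. Qed.

Lemma fnum_fden x : x = (fnum x)%:F / (fden x)%:F.
Proof. by rewrite /fnum /fden; case: cid => ? []. Qed.

Lemma fnum_eq0 x : (fnum x == 0) = (x == 0).
Proof.
by rewrite [in RHS](fnum_fden x) mulf_eq0 invr_eq0 !tofrac_eq0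
  (negPf (fden_neq0 x)) orbF.
Qed.

(** Stated without division, so that coefficients can be compared. *)
Lemma fnum_cross f g : g != 0 -> fnum (f%:F / g%:F) * g = f * fden (f%:F / g%:F).
Proof.
move=> ng; set x := _ / _.
have /eqP : f%:F / g%:F = (fnum x)%:F / (fden x)%:F by apply: fnum_fden.
by rewrite eqr_div ?tofrac_eq0 ?fden_neq0 // -!tofracM tofrac_eq => /eqP ->.
Qed.

(** The order of the numerator minus that of the denominator; [ser_valE] shows
that the choice of the fraction does not matter. *)
Definition ser_val (x : {fraction D}) : int :=
  (ser_ord (fnum x))%:Z - (ser_ord (fden x))%:Z.

Lemma ser_valE f g : f != 0 -> g != 0 ->
  ser_val (f%:F / g%:F) = (ser_ord f)%:Z - (ser_ord g)%:Z.
Proof.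
move=> nf ng; rewrite /ser_val; set x := _ / _.
have nx : fnum x != 0 by rewrite fnum_eq0 mulf_neq0 ?invr_eq0 ?tofrac_eq0.
have := congr1 ser_ord (fnum_cross f ng); rewrite -/x !ser_ordM ?fden_neq0 //.
move=> e; apply/eqP; rewrite subr_eq addrAC eq_sym subr_eq -!PoszD.
by rewrite eqz_nat -e.
Qed.

Lemma ser_valM x y : x != 0 -> y != 0 ->
  ser_val (x * y) = ser_val x + ser_val y.
Proof.
move=> nx ny; rewrite {1}(fnum_fden x) {1}(fnum_fden y) mulf_div -!tofracM.
rewrite ser_valE ?mulf_neq0 ?fnum_eq0 ?fden_neq0 //.
rewrite !ser_ordM ?fnum_eq0 ?fden_neq0 // /ser_val !PoszD.
by rewrite opprD addrACA.
Qed.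

Lemma ser_valD x y : x != 0 -> y != 0 -> x + y != 0 ->
  Num.min (ser_val x) (ser_val y) <= ser_val (x + y).
Proof.
move=> nx ny; rewrite {1 3}(fnum_fden x) {1 3}(fnum_fden y).
have [dx dy] := (fden_neq0 x, fden_neq0 y).
rewrite addf_div ?tofrac_eq0 // -!tofracM -tofracD mulf_eq0 negb_or tofrac_eq0.
move=> /andP[nz _]; rewrite ser_valE ?mulf_neq0 // lerBrDr.
apply: (@le_trans _ _ (minn (ser_ord (fnum x * fden y))
                            (ser_ord (fnum y * fden x)))%:Z); last first.
  by rewrite lez_nat ser_ordD.
rewrite !ser_ordM ?fnum_eq0 // !PoszD /ser_val.
have [le_xy|lt_yx] := leqP (ser_ord (fnum x) + ser_ord (fden y))
   (ser_ord (fnum y) + ser_ord (fden x)); rewrite -lerBrDr ge_min.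
  by rewrite PoszD opprD addrACA subrr addr0 lexx.
apply/orP; right; rewrite PoszD opprD [X in _ <= _ + X]addrC addrACA.
by rewrite subrr addr0.
Qed.

Lemma ser_val_int x1 (cx1 : c x1 0 = 0) (cx1' : c x1 1 != 0) (z : int) :
  exists2 x, x != 0 & ser_val x = z.
Proof.
have n1 : x1 != 0 by apply: contraNneq cx1' => ->; rewrite ser0.
have o1 : ser_ord x1 = 1%N.
  by apply: ser_ord_eq => // i; rewrite ltnS leqn0 => /eqP ->.
have oX n : ser_ord (x1 ^+ n) = n.
  elim: n => [|n IH]; first by rewrite expr0 ser_ord1.
  by rewrite exprS ser_ordM ?expf_neq0 // o1 IH.
case: (intP z) => [|n|n].
- exists (1%:F / 1%:F); first by rewrite tofrac1 divr1 oner_neq0.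
  by rewrite ser_valE ?oner_neq0 // subrr.
- exists ((x1 ^+ n.+1)%:F / 1%:F); last first.
    by rewrite ser_valE ?expf_neq0 ?oner_neq0 // oX ser_ord1 subr0.
  by rewrite tofrac1 divr1 tofrac_eq0 expf_neq0.
- exists (1%:F / (x1 ^+ n.+1)%:F); last first.
    by rewrite ser_valE ?expf_neq0 ?oner_neq0 // oX ser_ord1 sub0r.
  by rewrite tofrac1 mul1r invr_eq0 tofrac_eq0 expf_neq0.
Qed.

Lemma ser_val_const a : a != 0 -> ser_val (iota a) = 0.
Proof.
move=> na; have nj : jD a != 0.
  by apply: contraNneq (c_const na) => ->; rewrite ser0.
have oj : ser_ord (jD a) = 0%N by apply/eqP; rewrite -leqn0 ser_ord_le ?c_const.
by rewrite iotaE -[tofrac _]divr1 -tofrac1 ser_valE ?oner_neq0 // ser_ord1 oj subrr.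
Qed.

Variables (x1 : D) (cx1 : c x1 0 = 0) (cx1' : c x1 1 != 0).

(** An element [x1] whose image has order one makes the value group [Z]. *)
Definition ser_dval : dvaluation iota :=
  DValuation ser_valM ser_valD (ser_val_int cx1 cx1') ser_val_const.

Local Notation v := ser_dval.

Lemma ser_in_vring f : in_vring v f%:F.
Proof.
rewrite /in_vring tofrac_eq0; case: eqVneq => //= nf.
by rewrite -[tofrac _]divr1 -tofrac1 ser_valE ?oner_neq0 // ser_ord1 subr0.
Qed.

(** The reduction of the valuation ring into [Frac A]: the coefficient of the
numerator at the order of the denominator, over the leading coefficient of the
denominator. It is meaningful on the valuation ring only. *)
Definition ser_res (x : {fraction D}) : {fraction A} :=
  (c (fnum x) (ser_ord (fden x)))%:F / (c (fden x) (ser_ord (fden x)))%:F.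

Lemma ser_vringP f g : g != 0 ->
  in_vring v (f%:F / g%:F) <-> (forall i, (i < ser_ord g)%N -> c f i = 0).
Proof.
move=> ng; rewrite /in_vring mulf_eq0 invr_eq0 !tofrac_eq0 (negPf ng) orbF.
have [->|nf /=] := eqVneq f 0; first by split=> // _ i _; rewrite ser0.
rewrite ser_valE // subr_ge0 lez_nat; split=> [le_gf i lt_i|]; last exact: ser_ord_ge.
by apply: ser_ord_lt; apply: leq_trans lt_i le_gf.
Qed.

Lemma ser_vring_coef f g i : g != 0 -> in_vring v (f%:F / g%:F) ->
  (i < ser_ord g)%N -> c f i = 0.
Proof. by move=> ng /(ser_vringP f ng); apply. Qed.

(** The reduction can be computed from any fraction representing [x]. *)
Lemma ser_resE f g : g != 0 -> in_vring v (f%:F / g%:F) ->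
  ser_res (f%:F / g%:F) = (c f (ser_ord g))%:F / (c g (ser_ord g))%:F.
Proof.
move=> ng Vx; have lo := ser_vring_coef ng Vx; rewrite /ser_res.
have Vx' := Vx; rewrite (fnum_fden (_ / _)) in Vx'.
have lo' := ser_vring_coef (fden_neq0 _) Vx'; set x := _ / _ in lo' *.
apply/eqP; rewrite eqr_div ?tofrac_eq0 ?ser_ord_neq0 ?fden_neq0 //.
rewrite -!tofracM tofrac_eq.
have := congr1 (fun h => c h (ser_ord (fden x) + ser_ord g)%N) (fnum_cross f ng).
rewrite -/x /= ser_coefM_low //; last exact: ser_ord_lt.
by rewrite addnC ser_coefM_low => // [->|]; last exact: ser_ord_lt.
Qed.

Lemma ser_res_in_vmax x : in_vring v x -> in_vmax v x = (ser_res x == 0).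
Proof.
rewrite (fnum_fden x) => Vx; rewrite ser_resE ?fden_neq0 //.
have lo := ser_vring_coef (fden_neq0 x) Vx.
rewrite mulf_eq0 invr_eq0 !tofrac_eq0 [X in _ || X](negPf _) ?orbF; last first.
  by rewrite ser_ord_neq0 ?fden_neq0.
rewrite /in_vmax mulf_eq0 invr_eq0 !tofrac_eq0 (negPf (fden_neq0 x)) orbF.
case: eqVneq => [->|nf] /=; first by rewrite ser0 eqxx.
rewrite ser_valE ?fden_neq0 // subr_gt0 ltz_nat.
apply/idP/eqP => [/ser_ord_lt //|c0]; rewrite ltn_neqAle ser_ord_ge // andbT.
by apply: contra_eqN c0 => /eqP ->; rewrite ser_ord_neq0.
Qed.

Lemma ser_resM x y : in_vring v x -> in_vring v y ->
  ser_res (x * y) = ser_res x * ser_res y.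
Proof.
move=> Vx Vy; have := in_vringM Vx Vy; move: Vx Vy.
rewrite (fnum_fden x) (fnum_fden y) mulf_div -!tofracM => Vx Vy Vxy.
have [dx dy] := (fden_neq0 x, fden_neq0 y).
rewrite !ser_resE ?mulf_neq0 // mulf_div -!tofracM ser_ordM //.
by rewrite !ser_coefM_low //; do ?[exact: ser_ord_lt];
  move=> i; apply: ser_vring_coef.
Qed.

Lemma ser_resD x y : in_vring v x -> in_vring v y ->
  ser_res (x + y) = ser_res x + ser_res y.
Proof.
move=> Vx Vy; have Vxy : in_vring v (x + y).
  rewrite -[y]opprK; apply: in_vringB => //.
  by rewrite -[- y]sub0r; apply: in_vringB => //; rewrite /in_vring eqxx.
move: Vx Vy Vxy; have [dx dy] := (fden_neq0 x, fden_neq0 y).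
rewrite (fnum_fden x) (fnum_fden y) addf_div ?tofrac_eq0 // -!tofracM -tofracD.
move=> Vx Vy Vxy.
have lx := ser_vring_coef dx Vx; have ly := ser_vring_coef dy Vy.
rewrite !ser_resE ?mulf_neq0 // addf_div ?tofrac_eq0 ?ser_ord_neq0 //.
rewrite -!tofracM -tofracD ser_ordM // cD ser_coefM_low //; last exact: ser_ord_lt.
rewrite addnC [c (fnum y * _) _]ser_coefM_low //; last exact: ser_ord_lt.
by rewrite addnC ser_coefM_low //; exact: ser_ord_lt.
Qed.

Lemma ser_res_tofrac f : ser_res f%:F = (c f 0)%:F / (c 1 0)%:F.
Proof.
rewrite -[tofrac f]divr1 -tofrac1 ser_resE ?oner_neq0 ?ser_ord1 //.
by rewrite tofrac1 divr1 ser_in_vring.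
Qed.

End SeriesValuation.

(** * Transcendence degree of the residue field *)

(** [res] is a morphism from the valuation ring to [k(u_0, ..., u_(m-1))] with
kernel the maximal ideal, and [T] lifts the variables [u_i]. Such a [res] embeds
the residue field into [k(u)], and the classes of the [T i] generate its image;
hence the residue field has transcendence degree [m]. *)
Section Dimension.
Variables (k K : fieldType) (iota : {rmorphism k -> K}) (v : dvaluation iota).
Variables (m : nat) (res : K -> {fraction {mpoly k[m]}}) (T : 'I_m -> K).
Hypothesis resD : forall x y, in_vring v x -> in_vring v y ->
  res (x + y) = res x + res y.
Hypothesis resM : forall x y, in_vring v x -> in_vring v y ->
  res (x * y) = res x * res y.
Hypothesis res_eq0 : forall x, in_vring v x -> in_vmax v x = (res x == 0).
Hypothesis res_const : forall a, res (iota a) = tofrac a%:MP.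
Hypothesis T_vring : forall i, in_vring v (T i).
Hypothesis res_T : forall i, res (T i) = tofrac 'X_i.

Local Notation "x %:F" := (tofrac x).

Let S i : vring v := VRing (T_vring i : T i \in in_vring v).
Let ev (p : {mpoly k[m]}) : vring v := mmap (vring_const v) S p.

Lemma vring_valP (x : vring v) : in_vring v (vring_val x).
Proof. by case: x. Qed.
#[local] Hint Resolve vring_valP : core.

Lemma res_mmap p : res (vring_val (ev p)) = p%:F.
Proof.
rewrite /ev; elim/mpolyind: p => [|c M p _ _ IH].
  by rewrite mmap0 -(rmorph0 (vring_const v)) /= res_const mpolyC0.
rewrite mmapD mmapZ mmapX vring_valD vring_valM.
rewrite resD; [|exact: in_vringM|exact: vring_valP].
rewrite resM; [|exact: vring_valP|exact: vring_valP].
rewrite IH tofracD; congr (_ + _); rewrite res_const -mul_mpolyC tofracM; congr (_ * _).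
have res_prod (I : Type) (s : seq I) (F : I -> vring v) (G : I -> {mpoly k[m]}) :
    (forall i, res (vring_val (F i)) = (G i)%:F) ->
  res (vring_val (\prod_(i <- s) F i)) = (\prod_(i <- s) G i)%:F.
  move=> FG; elim: s => [|i s IHs].
    by rewrite !big_nil -(rmorph1 (vring_const v)) /= res_const mpolyC1.
  by rewrite !big_cons vring_valM resM // IHs FG tofracM.
rewrite mpolyXE_id; apply: res_prod => i.
elim: (M i) => [|e IHe].
  by rewrite !expr0 -(rmorph1 (vring_const v)) /= res_const mpolyC1.
by rewrite !exprS vring_valM resM // IHe res_T tofracM.
Qed.

Let t i : vresidue v := \pi_(vresidue v) (S i).

Lemma pi_mmap p : mmap (vresidue_const v) t p = \pi_(vresidue v) (ev p).
Proof.
rewrite /ev /mmap [RHS]rmorph_sum; apply: eq_bigr => M _.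
by rewrite rmorphM; congr (_ * _); rewrite /mmap1 rmorph_prod;
  apply: eq_bigr => i _; rewrite rmorphXn.
Qed.

Lemma mmap_residue_eq0 p : (mmap (vresidue_const v) t p == 0) = (p == 0).
Proof.
rewrite pi_mmap pi_vresidue_eq0 -[val _]/(vring_val _) res_eq0 //.
by rewrite res_mmap tofrac_eq0.
Qed.

(** Every residue class lies in the field generated by the classes of the
[T i], so it is a root of a polynomial ['X - x] over that field. *)
Lemma has_dimension_residue_map : has_dimension v m.
Proof.
exists t; split=> [p /eqP|x].
  by rewrite mmap_residue_eq0 => /eqP.
exists ('X - x%:P); split; [by rewrite polyXsubC_eq0| |by rewrite root_XsubC].
have gen0 : gen_subfield (vresidue_const v) t 0.
  by exists 0, 1; rewrite mmap0 mul0r mmap_residue_eq0 oner_neq0.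
have gen1 : gen_subfield (vresidue_const v) t 1.
  by exists 1, 1; rewrite mmap_residue_eq0 oner_neq0 divff ?mmap_residue_eq0 ?oner_neq0.
suff genx : gen_subfield (vresidue_const v) t (- x).
  move=> i; rewrite coefB coefX coefC.
  by case: i => [|[|i]]; rewrite /= ?subr0 ?sub0r.
rewrite -(reprK x); set y := repr x.
(* If the residue of y is a / b, then the class of y is a(t) / b(t). *)
have [[a b] [nb resy]] := fraction_quot (res (vring_val y)); rewrite /= in nb resy.
exists (- a), b; rewrite mmap_residue_eq0; split=> //.
rewrite mmapN mulNr; congr (- _); apply: (canRL (mulfK _)).
  by rewrite mmap_residue_eq0.
apply/eqP; rewrite -subr_eq0 !pi_mmap -rmorphM -rmorphB pi_vresidue_eq0.
rewrite -[val _]/(vring_val _) res_eq0 //; set z := y * ev b - ev a.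
(* As res is additive, res z = 0 follows by comparing z + ev a with y * ev b. *)
have /eqP : res (vring_val (z + ev a)) = res (vring_val (y * ev b)) by rewrite subrK.
rewrite vring_valD vring_valM.
rewrite resD; [|exact: vring_valP|exact: vring_valP].
rewrite resM; [|exact: vring_valP|exact: vring_valP].
rewrite !res_mmap resy.
have nbF : tofrac b != 0 by rewrite tofrac_eq0.
rewrite (divfK nbF).
by rewrite -[X in _ == X]add0r (inj_eq (addIr _)).
Qed.

End Dimension.

(** * Truncations and first-order Taylor expansion *)

Section PolyLow.
Variable A : comNzRingType.
Implicit Types (p q : {poly A}) (d : nat).

(** [p] is divisible by ['X^d]. *)
Definition poly_low d p := forall i, (i < d)%N -> p`_i = 0.

(** Congruence modulo ['X^d]. *)
Definition poly_eqmod d p q := forall i, (i < d)%N -> p`_i = q`_i.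

Lemma poly_lowW d e p : (e <= d)%N -> poly_low d p -> poly_low e p.
Proof. by move=> le_ed lp i lt_i; apply: lp; apply: leq_trans le_ed. Qed.

Lemma poly_low0 d : poly_low d 0.
Proof. by move=> i _; rewrite coef0. Qed.

Lemma poly_lowD d p q : poly_low d p -> poly_low d q -> poly_low d (p + q).
Proof. by move=> lp lq i lt_i; rewrite coefD lp ?lq ?addr0. Qed.

Lemma poly_low_sum d (I : Type) (s : seq I) (P : pred I) (F : I -> {poly A}) :
  (forall i, P i -> poly_low d (F i)) -> poly_low d (\sum_(i <- s | P i) F i).
Proof. by apply: big_ind; [exact: poly_low0 | exact: poly_lowD]. Qed.

Lemma poly_lowM a b p q :
  poly_low a p -> poly_low b q -> poly_low (a + b) (p * q).
Proof. by move=> lp lq N ltN; rewrite coefM (cauchy_prod_lt lp lq). Qed.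

Lemma coefM_low a b p q :
  poly_low a p -> poly_low b q -> (p * q)`_(a + b) = p`_a * q`_b.
Proof. by move=> lp lq; rewrite coefM (cauchy_prod_low lp lq). Qed.

Lemma coef_sumM_low (I : finType) a b (p q : I -> {poly A}) :
    (forall i, poly_low a (p i)) -> (forall i, poly_low b (q i)) ->
  (\sum_i p i * q i)`_(a + b) = \sum_i (p i)`_a * (q i)`_b.
Proof.
by move=> lp lq; rewrite coef_sum; apply: eq_bigr => i _; apply: coefM_low.
Qed.

Lemma poly_lowMl d p q : poly_low d q -> poly_low d (p * q).
Proof. by move=> lq; rewrite -[d]add0n; apply: poly_lowM. Qed.

Lemma poly_lowMr d p q : poly_low d p -> poly_low d (p * q).
Proof. by rewrite mulrC; apply: poly_lowMl. Qed.

Lemma poly_lowX d p : poly_low 1 p -> poly_low d (p ^+ d).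
Proof.
move=> lp; elim: d => [|d IH] //; rewrite exprS -add1n.
exact: poly_lowM.
Qed.

Lemma poly_low_prod (I : Type) (s : seq I) (F : I -> {poly A}) (e : I -> nat) :
  (forall i, poly_low (e i) (F i)) ->
  poly_low (\sum_(i <- s) e i) (\prod_(i <- s) F i).
Proof.
move=> lF; elim: s => [|i s IH]; first by rewrite !big_nil.
by rewrite !big_cons; apply: poly_lowM.
Qed.

Lemma poly_eqmodP d p q : poly_eqmod d p q <-> poly_low d (p - q).
Proof.
split=> e i lt_i; first by rewrite coefB e ?subrr.
by apply/eqP; rewrite -subr_eq0 -coefB e.
Qed.

End PolyLow.

Section MmapPoly.
Variables (n : nat) (k A : comNzRingType) (cA : {rmorphism k -> {poly A}}).
Implicit Types (y h : 'I_n -> {poly A}) (F G : {mpoly k[n]}).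

Lemma mmap_low y F d :
    (forall i, poly_low 1 (y i)) ->
    (forall M, (mdeg M < d)%N -> F@_M = 0) ->
  poly_low d (mmap cA y F).
Proof.
move=> ly lF; apply: poly_low_sum => M _; have [/lF ->|le_d] := ltnP (mdeg M) d.
  by rewrite rmorph0 mul0r; apply: poly_low0.
apply: poly_lowMl; apply: (poly_lowW le_d); rewrite mdegE.
by apply: poly_low_prod => i; apply: poly_lowX.
Qed.

Let taylor_rem y h F := mmap cA (fun i => y i + h i) F
  - (mmap cA y F + \sum_(i < n) h i * mmap cA y F^`M(i)).

(** The Taylor expansion of [F] at [y] is linear in [h] modulo the square of
the ideal ['X^d]. The property passes from two polynomials to their sum and, by
the Leibniz rule, to their product, so constants and variables suffice. *)
Lemma mmap_taylor1 y h F d : (forall i, poly_low d (h i)) ->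
  poly_low (d + d) (taylor_rem y h F).
Proof.
move=> lh; pose a G := mmap cA y G; pose al G := \sum_(i < n) h i * a G^`M(i).
have lal G : poly_low d (al G).
  by apply: poly_low_sum => i _; apply: poly_lowMr.
have remE G : mmap cA (fun i => y i + h i) G = a G + al G + taylor_rem y h G.
  by rewrite addrC subrK.
have lC c : poly_low (d + d) (taylor_rem y h c%:MP).
  rewrite /taylor_rem !mmapC big1 ?addr0 ?subrr; first exact: poly_low0.
  by move=> i _; rewrite mderivC mmap0 mulr0.
have lD G H : poly_low (d + d) (taylor_rem y h G) ->
    poly_low (d + d) (taylor_rem y h H) -> poly_low (d + d) (taylor_rem y h (G + H)).
  move=> lG lH; have -> : taylor_rem y h (G + H) = taylor_rem y h G + taylor_rem y h H.
    rewrite /taylor_rem !mmapD.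
    under eq_bigr do rewrite mderivD mmapD mulrDr.
    by rewrite big_split /= [in RHS]addrACA -opprD; congr (_ - _); rewrite addrACA.
  exact: poly_lowD.
have lM G H : poly_low (d + d) (taylor_rem y h G) ->
    poly_low (d + d) (taylor_rem y h H) -> poly_low (d + d) (taylor_rem y h (G * H)).
  move=> lG lH; rewrite {1}/taylor_rem rmorphM /= !remE.
  have -> : \sum_(i < n) h i * mmap cA y (G * H)^`M(i) = al G * a H + a G * al H.
    rewrite /al mulr_suml mulr_sumr -big_split /=; apply: eq_bigr => i _.
    by rewrite mderivM mmapD !rmorphM /= -/(a H) -/(a G); ring.
  rewrite rmorphM /= -/(a G) -/(a H).
  have -> : (a G + al G + taylor_rem y h G) * (a H + al H + taylor_rem y h H) -
     (a G * a H + (al G * a H + a G * al H)) =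
     al G * al H + ((a G + al G) * taylor_rem y h H +
       taylor_rem y h G * (a H + al H + taylor_rem y h H)) by ring.
  apply: poly_lowD; first exact: poly_lowM.
  by apply: poly_lowD; [apply: poly_lowMl | apply: poly_lowMr].
have lX i : poly_low (d + d) (taylor_rem y h 'X_i).
  rewrite /taylor_rem !mmapX !mmap1U (bigD1 i) //= big1 ?addr0; last first.
    move=> j ne_j; rewrite mderivX mnm1E eq_sym (negPf ne_j) scale0r mmap0.
    by rewrite mulr0.
  rewrite mderivX mnm1E eqxx scale1r -{1}[U_(i)%MM]add0m addmK mpolyX0 rmorph1.
  rewrite mulr1 subrr.
  exact: poly_low0.
elim/mpolyind: F => [|c M p _ _ IH]; first by rewrite -mpolyC0; apply: lC.
apply: lD => //; rewrite -mul_mpolyC; apply: (lM) => //.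
rewrite mpolyXE_id; elim/big_ind: _ => [||i _]; [by rewrite -mpolyC1| by [] |].
elim: (M i) => [|e IHe]; first by rewrite expr0 -mpolyC1.
by rewrite exprS; apply: lM.
Qed.

Lemma mmap_eqmod y y' F d :
  (forall i, poly_eqmod d (y i) (y' i)) ->
  poly_eqmod d (mmap cA y F) (mmap cA y' F).
Proof.
move=> e; apply/poly_eqmodP; have lh i : poly_low d (y i - y' i) by apply/poly_eqmodP.
have := @mmap_taylor1 y' (fun i => y i - y' i) F d lh; rewrite /taylor_rem.
have -> : mmap cA (fun i => y' i + (y i - y' i)) F = mmap cA y F.
  apply: eq_bigr => M _; congr (_ * _); apply: eq_bigr => i _.
  by rewrite addrC subrK.
set S := \sum_(i < n) _ => lt.
have -> : mmap cA y F - mmap cA y' F = mmap cA y F - (mmap cA y' F + S) + S by ring.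
apply: poly_lowD; first by rewrite -[d]add0n; apply: poly_lowW lt; rewrite leq_add2r.
by apply: poly_low_sum => i _; apply: poly_lowMr.
Qed.

End MmapPoly.

(** * Substitution of series without constant term *)

Section Substitution.
Variables (n : nat) (k A : comNzRingType) (cA : {rmorphism k -> A}).
Variable x : 'I_n -> nat -> A.
Hypothesis x0 : forall i, x i 0 = 0.
Implicit Types (f g : {fps k[n]}) (F : {mpoly k[n]}).

(** The series [\sum_j x i j t^j] cut off after the term of degree [D]. *)
Definition series_trunc (D : nat) (i : 'I_n) : {poly A} := \poly_(j < D.+1) x i j.

(** The coefficient of [t^N] in [f(x_0, x_1, ...)]. As the [x i] have no constant
term, only the terms of [f] of degree at most [N] and the terms of the [x i] of
degree at most [N] contribute. *)
Definition fps_subst f (N : nat) : A :=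
  (mmap (polyC \o cA) (series_trunc N) (fps_trunc N.+1 f))`_N.

Lemma series_trunc_low D i : poly_low 1 (series_trunc D i).
Proof. by case=> // _; rewrite coef_poly /= x0. Qed.

(** The cut-offs for [f] and for the [x i] may be taken anywhere above [N]. *)
Lemma fps_substE f N D d F : (N <= D)%N -> (N < d)%N ->
    (forall M, (mdeg M < d)%N -> F@_M = fps_coef f M) ->
  fps_subst f N = (mmap (polyC \o cA) (series_trunc D) F)`_N.
Proof.
move=> le_ND lt_Nd Ff.
transitivity (mmap (polyC \o cA) (series_trunc D) (fps_trunc N.+1 f))`_N.
  apply: (@mmap_eqmod _ _ _ _ _ _ _ N.+1) => // i j lt_j.
  by rewrite !coef_poly lt_j ltnS (leq_trans _ le_ND) // -ltnS.
apply/eqP; rewrite -subr_eq0 -coefB -mmapB.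
rewrite (@mmap_low _ _ _ _ _ _ N.+1) // => [i|M lt_M].
  exact: series_trunc_low.
by rewrite mcoeffB mcoeff_trunc lt_M Ff ?subrr // (leq_trans lt_M).
Qed.

Lemma fps_substD f g N : fps_subst (f + g) N = fps_subst f N + fps_subst g N.
Proof. by rewrite /fps_subst fps_truncD mmapD coefD. Qed.

Lemma fps_substM f g N :
  fps_subst (f * g) N = \sum_(i < N.+1) fps_subst f i * fps_subst g (N - i).
Proof.
rewrite (@fps_substE _ N N N.+1 (fps_trunc N.+1 f * fps_trunc N.+1 g)) //.
  rewrite rmorphM /= coefM; apply: eq_bigr => i _; congr (_ * _).
    apply/esym/(@fps_substE _ _ _ N.+1) => // [|M /fps_coef_trunc -> //].
    by rewrite -ltnS.
  apply/esym/(@fps_substE _ _ _ N.+1) => [||M /fps_coef_trunc -> //].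
    exact: leq_subr.
  by rewrite ltnS leq_subr.
by move=> M lt_M; rewrite -(fps_coefM _ _ lt_M).
Qed.

Lemma fps_subst_coef0 f : fps_subst f 0 = cA (fps_coef f 0%MM).
Proof.
rewrite (@fps_substE _ 0 0 1 (fps_coef f 0%MM)%:MP) //.
  by rewrite mmapC /= coefC.
by move=> M; rewrite ltnS leqn0 mdeg_eq0 => /eqP ->; rewrite mcoeffC eqxx mulr1.
Qed.

Lemma fps_substX i N : fps_subst (fpsX k i) N = x i N.
Proof.
rewrite (@fps_substE _ N N N.+1 'X_i) //.
  by rewrite mmapX mmap1U coef_poly ltnSn.
by move=> M _; rewrite mcoeffX /= eq_sym.
Qed.

(** The formal partial derivative with respect to the [i]-th variable. *)
Definition fps_deriv (i : 'I_n) f : {fps k[n]} :=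
  FPS (fun M => fps_coef f (M + U_(i))%MM *+ (M i).+1).

End Substitution.

(** * Injectivity of the substitution *)

Section Injectivity.
Variables (n m : nat) (k : fieldType) (x : 'I_n -> nat -> {mpoly k[m]}).
Hypothesis x0 : forall i, x i 0 = 0.
Local Notation A := {mpoly k[m]}.
Local Notation subst := (fps_subst (@mpolyC m k) x).

(** For every [i] there are arbitrarily large degrees [J] at which [x i] alone has
a nonzero coefficient, one that has a much larger degree in [u] than all earlier
coefficients of all the series: these have degree at most [B] in [u], so that a
coefficient of [t^(r + J)] formed from them has degree at most [(r + J) * B].
Here [msize] is one more than the total degree. *)
Definition independently_growing := forall i r, exists J B : nat,
  [/\ (r < J)%N, forall j i', (j < J)%N -> (msize (x i' j) <= B.+1)%N,
      forall i', i' != i -> x i' J = 0 &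
      ((r + J) * B + 1 < msize (x i J))%N].

(** The coefficient of [t^N] has total degree at most [N * B] in [u]. Such
polynomials form a subring containing [k], which bounds every value
[F(y_0, y_1, ...)] with [y_i] in it. *)
Let bounded B (p : {poly A}) := forall N, (msize p`_N <= N * B + 1)%N.

Lemma bounded0 B : bounded B 0.
Proof. by move=> N; rewrite coef0 msize0. Qed.

Lemma boundedC B (c : k) : bounded B (c%:MP)%:P.
Proof.
move=> N; rewrite coefC; case: eqP => _; last by rewrite msize0.
by rewrite addn1 msizeC; case: eqP.
Qed.

Lemma boundedD B p q : bounded B p -> bounded B q -> bounded B (p + q).
Proof.
move=> bp bq N; rewrite coefD; apply: leq_trans (msizeD_le _ _) _.
by rewrite geq_max bp bq.
Qed.

Lemma msize_sum_le (I : Type) (s : seq I) (P : pred I) (F : I -> A) b :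
  (forall i, P i -> msize (F i) <= b)%N -> (msize (\sum_(i <- s | P i) F i) <= b)%N.
Proof.
move=> le_b; elim/big_ind: _ => // [|p q lp lq]; first by rewrite msize0.
by apply: leq_trans (msizeD_le _ _) _; rewrite geq_max lp lq.
Qed.

Lemma boundedM B p q : bounded B p -> bounded B q -> bounded B (p * q).
Proof.
move=> bp bq N; rewrite coefM; apply: msize_sum_le => i _.
have [->|np] := eqVneq p`_i 0; first by rewrite mul0r msize0.
have [->|nq] := eqVneq q`_(N - i) 0; first by rewrite mulr0 msize0.
rewrite msizeM //; have := bp i; have := bq (N - i)%N.
have le_iN : (i <= N)%N by rewrite -ltnS.
have -> : (N * B = i * B + (N - i) * B)%N by rewrite -mulnDl subnKC.
move=> b1 b2; rewrite -subn1 leq_subLR.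
by apply: leq_trans (leq_add b2 b1) _; rewrite addnACA addnCA.
Qed.

Lemma bounded_mmap B (y : 'I_n -> {poly A}) F : (forall i, bounded B (y i)) ->
  bounded B (mmap (polyC \o @mpolyC m k) y F).
Proof.
move=> by_; rewrite /mmap; elim/big_ind: _ => [||M _]; first exact: bounded0.
  exact: boundedD.
apply: boundedM; first exact: boundedC.
rewrite /mmap1; elim/big_ind: _ => [||i _]; first exact: (boundedC B 1).
  exact: boundedM.
elim: (M i) => [|e IH]; first exact: (boundedC B 1).
by rewrite exprS; apply: boundedM.
Qed.

(** The kernel of the substitution is closed under partial derivatives. *)
Lemma fps_subst_deriv_eq0 f : independently_growing ->
  (forall N, subst f N = 0) -> forall i N, subst (fps_deriv i f) N = 0.
Proof.
move=> grow f0.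
pose P r := [exists i, subst (fps_deriv i f) r != 0].
suff noP r : ~~ P r.
  by move=> i N; apply: contraNeq (noP N) => ?; apply/existsP; exists i.
apply/negP => Pr; have exP : exists r, P r by exists r.
(* r is the least order in t of the images of the partial derivatives of f. *)
case: (ex_minnP exP) => {Pr}r /existsP[i nz] min_r.
have [J [B [lt_rJ le_B xJ0 lt_xJ]]] := grow i r.
(* The contradiction is found in the coefficient of t^N, from the expansion of
   f at y, the truncation of x below J, with increment h = x - y. *)
pose N := (J + r)%N.
pose F := fps_trunc N.+2 f; pose y i' : {poly A} := \poly_(j < J) x i' j.
pose h i' := series_trunc x N i' - y i'.
pose ev (z : 'I_n -> {poly A}) := mmap (polyC \o @mpolyC m k) z.
have lh i' : poly_low J (h i').
  move=> j lt_j; rewrite coefB !coef_poly lt_j ltnS ifT ?subrr //.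
  by rewrite (leq_trans (ltnW lt_j)) ?leq_addr.
have hJ i' : (h i')`_J = x i' J.
  by rewrite coefB !coef_poly ltnn subr0 ltnS leq_addr.
have dF i' : F^`M(i') = fps_trunc N.+1 (fps_deriv i' f).
  apply/mpolyP => M; rewrite mcoeff_deriv !mcoeff_trunc mdegD mdeg1 addn1 ltnS.
  by case: ifP => // _; rewrite mul0rn.
(* y and x agree modulo t^J and r < J, so up to t^r the derivatives take the
   same values at both. *)
have evdF i' s : (s <= r)%N -> (ev y F^`M(i'))`_s = subst (fps_deriv i' f) s.
  move=> le_sr; have lt_sJ := leq_ltn_trans le_sr lt_rJ.
  rewrite (@fps_substE _ _ _ _ _ x0 _ s N N.+1 F^`M(i')).
  - apply: (@mmap_eqmod _ _ _ _ _ _ _ J) => // i'' j lt_j.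
    rewrite !coef_poly lt_j ltnS ifT // (leq_trans (ltnW lt_j)) ?leq_addr //.
  - by rewrite (leq_trans le_sr) ?leq_addl.
  - by rewrite ltnS (leq_trans le_sr) ?leq_addl.
  by move=> M lt_M; rewrite dF -fps_coef_trunc.
have lev i' : poly_low r (ev y F^`M(i')).
  move=> s lt_s; rewrite evdF 1?ltnW //; apply: contraTeq lt_s => nz_s.
  by rewrite -leqNgt min_r //; apply/existsP; exists i'.
have : (ev (fun i' => y i' + h i') F)`_N = 0.
  transitivity (subst f N); last exact: f0.
  rewrite (@fps_substE _ _ _ _ _ x0 _ N N N.+2 F) //.
    by congr (ev _ F)`_N; apply: funext => i'; rewrite addrC subrK.
  by move=> M lt_M; rewrite -fps_coef_trunc.
have linE : (\sum_(i' < n) h i' * ev y F^`M(i'))`_N = x i J * subst (fps_deriv i f) r.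
  transitivity (\sum_i' x i' J * subst (fps_deriv i' f) r).
    rewrite (coef_sumM_low lh lev); apply: eq_bigr => i' _.
    by congr (_ * _); [exact: hJ | exact: evdF].
  rewrite (bigD1 i isT) /= big1 ?addr0 // => i' ne.
  by rewrite (xJ0 _ ne) mul0r.
(* The remainder is divisible by t^(2J), hence does not reach t^N. *)
have lt_N : (N < J + J)%N by rewrite ltn_add2l.
have /poly_eqmodP/(_ N lt_N) -> := @mmap_taylor1 _ _ _ (polyC \o @mpolyC m k) y h F J lh.
rewrite coefD [X in _ + X]linE => /eqP; rewrite addr_eq0 => /eqP e.
have by_ i' : bounded B (y i').
  move=> [|j]; rewrite coef_poly; case: ifP => lt_j; rewrite ?msize0 //.
    by rewrite x0 msize0.
  by apply: leq_trans (le_B _ _ lt_j) _; rewrite mulSn addn1 ltnS leq_addr.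
have := bounded_mmap F by_ N; rewrite -/(ev _ _) e msizeN leqNgt => /negP; apply.
have nxJ : x i J != 0.
  by apply: contraTneq lt_xJ => ->; rewrite msize0.
rewrite msizeM // /N [(J + r)%N]addnC; apply: (leq_trans lt_xJ).
rewrite -ltnS prednK.
  by rewrite -[X in (X < _)%N]addn0 ltn_add2l lt0n msize_poly_eq0.
by rewrite addn_gt0 !lt0n !msize_poly_eq0 nxJ.
Qed.

(** Induction on the degree of a monomial [M] that occurs in [f]: it is lowered
by differentiating, which in characteristic zero keeps the coefficient nonzero. *)
Lemma fps_subst_inj f : [pchar k] =i pred0 -> independently_growing ->
  f != 0 -> exists N, subst f N != 0.
Proof.
move=> char0 grow nf.
have [M nfM] : exists M, fps_coef f M != 0.
  have [//|noM] := pselect (exists M, fps_coef f M != 0).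
  case/eqP: nf; apply/fpsP => M; apply/eqP/negPn/negP => nM.
  by apply: noM; exists M.
move: {2}(mdeg M) (erefl (mdeg M)) => d; elim: d f M nfM {nf} => [|d IH] f M nfM.
  move=> /eqP; rewrite mdeg_eq0 => /eqP M0; exists 0%N.
  by rewrite (fps_subst_coef0 _ x0) mpolyC_eq0 -M0.
move=> dM; have [i nMi] : exists i, M i != 0%N.
  apply/existsP; apply: contraPT dM; rewrite negb_exists => /forallP Mi0.
  by rewrite mdegE big1 // => i _; have := Mi0 i; rewrite negbK => /eqP.
have leM : (U_(i) <= M)%MM by rewrite lep1mP.
have [N nzN]: exists N, subst (fps_deriv i f) N != 0.
  apply: (IH _ (M - U_(i))%MM).
    rewrite /= submK // -mulr_natr mulf_neq0 //.
    by rewrite ((pcharf0P k).1 char0).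
  by apply/eqP; rewrite -eqSS -dM -{2}(submK leM) mdegD mdeg1 addn1.
have [//|noN] := pselect (exists N, subst f N != 0).
case/eqP: nzN; apply: fps_subst_deriv_eq0 => // N'.
by apply/eqP/negPn/negP => nN'; apply: noN; exists N'.
Qed.

End Injectivity.

(** * The maximal ideal of the power series ring *)

Lemma fps_trunc_fpsX (n : nat) (k : comNzRingType) (i : 'I_n) d :
  fps_trunc d.+2 (fpsX k i) = 'X_i.
Proof.
apply/mpolyP => M; rewrite mcoeff_trunc mcoeffX /= eq_sym.
by case: eqP => [<-|]; rewrite ?mdeg1 //; case: ifP.
Qed.

Lemma fps_coefMX (n : nat) (k : comNzRingType) (g : {fps k[n]}) (i : 'I_n) M :
  fps_coef (g * fpsX k i) M = if M i == 0%N then 0 else fps_coef g (M - U_(i))%MM.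
Proof.
rewrite (@fps_coefM _ _ (mdeg M).+2) // fps_trunc_fpsX; case: eqP => [Mi0|/eqP nMi].
  rewrite mcoeffM big1 // => -[a b] /= /eqP /(congr1 (fun M' : 'X_{1..n} => M' i)).
  rewrite Mi0 mcoeffX mnmDE; case: eqP => [<-|]; last by rewrite mulr0.
  by rewrite mnm1E eqxx addn1.
have leM : (U_(i) <= M)%MM by rewrite lep1mP.
rewrite -{1}(submK leM) addmC mcoeffMX -fps_coef_trunc //.
by rewrite ltnS (leq_trans (mdegB _ _)).
Qed.

Lemma fps_maxidealP (n : nat) (k : fieldType) (f : {fps k[n]}) :
  fps_maxideal f <-> fps_coef f 0%MM = 0.
Proof.
have coef_sum (g : 'I_n -> {fps k[n]}) M :
    fps_coef (\sum_(i < n) g i * fpsX k i) M =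
    \sum_(i < n) fps_coef (g i * fpsX k i) M.
  by elim/big_rec2: _ => // i y1 y2 _ <-.
split=> [[g ->]|f0].
  by rewrite coef_sum big1 // => i _; rewrite fps_coefMX mnm0E eqxx.
(* Each monomial M other than 1 is assigned to one variable dividing it. *)
exists (fun i => FPS (fun M =>
  if [pick j | (M + U_(i))%MM j != 0%N] == Some i then fps_coef f (M + U_(i))%MM
  else 0)).
apply/fpsP => M; rewrite coef_sum.
have termE i : fps_coef (FPS (fun M => if [pick j | (M + U_(i))%MM j != 0%N] == Some i
      then fps_coef f (M + U_(i))%MM else 0) * fpsX k i) M =
    if [pick j | M j != 0%N] == Some i then fps_coef f M else 0.
  rewrite fps_coefMX /=; case: eqVneq => [Mi0|nMi]; last by rewrite submK ?lep1mP.
  by case: pickP => // j nMj; case: eqP => // -[ji]; rewrite ji Mi0 in nMj.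
rewrite (eq_bigr _ (fun i _ => termE i)); case: pickP => [i nMi|M0].
  rewrite (bigD1 i) //= eqxx big1 ?addr0 // => j ne_j.
  by case: eqP => // -[ij]; rewrite ij eqxx in ne_j.
rewrite big1 //; suff -> : M = 0%MM by [].
by apply/mnmP => i; rewrite mnm0E; apply/eqP/negbFE/M0.
Qed.

(** * A family of lacunary series *)

Section LacunarySeries.
Variables (n m : nat) (k : fieldType) (lt_m : (0 < m)%N) (lt_mn : (m < n)%N).

(** The coefficients of degree one: [1, u_0, ..., u_(m-1), 0, 0, ...]. *)
Definition lead_coord (i : nat) : {mpoly k[m]} :=
  if i == 0%N then 1 else if insub i.-1 is Some u then 'X_u else 0.

(** The coefficient of [t^j] in the series substituted for [X_i]: for [j >= 2] it
is [u_0 ^ (2j)!] if [j] is congruent to [i] modulo [n], and [0] otherwise. *)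
Definition lacunary_series (i : 'I_n) (j : nat) : {mpoly k[m]} :=
  if j == 0%N then 0 else if j == 1%N then lead_coord i
  else if (j %% n)%N == i then 'X_[U_(Ordinal lt_m) *+ (j.*2)`!] else 0.

Lemma msize_lead_coord i : (msize (lead_coord i) <= 2)%N.
Proof.
rewrite /lead_coord; case: eqP => _; first by rewrite msize1.
by case: insubP => [u _ _|_]; rewrite ?msize0 // msizeX mdeg1.
Qed.

Lemma lacunary_growing : independently_growing lacunary_series.
Proof.
move=> i r; have n_gt0 : (0 < n)%N by apply: leq_ltn_trans lt_mn.
pose J := (n * r.+2 + i)%N; pose B := (J.-1.*2)`!.
have leJ : (r.+2 <= J)%N by rewrite (leq_trans (leq_pmull _ n_gt0)) ?leq_addr.
have J_gt0 : (0 < J)%N by apply: leq_trans leJ.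
have B_gt0 : (0 < B)%N by apply: fact_gt0.
have seriesJ i' : lacunary_series i' J =
    if i == i' then 'X_[U_(Ordinal lt_m) *+ (J.*2)`!] else 0.
  rewrite /lacunary_series (gtn_eqF J_gt0) (gtn_eqF (leq_trans _ leJ)) //.
  by rewrite {1}/J mulnC modnMDl modn_small.
exists J, B; split.
- by apply: leq_trans leJ.
- move=> j i' lt_j; rewrite /lacunary_series.
  case: eqP => [_|_]; first by rewrite msize0.
  case: eqP => [_|_]; first by rewrite (leq_trans (msize_lead_coord _)).
  case: eqP => _; last by rewrite msize0.
  rewrite msizeX mdegMn mdeg1 mul1n ltnS leq_fact // leq_double.
  by rewrite -ltnS prednK.
- by move=> i' ne; rewrite seriesJ eq_sym (negPf ne).
(* (r + J) * B < 2J * B <= 2J * (2J - 1) * (2J - 2)! = (2J)! *)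
rewrite seriesJ eqxx msizeX mdegMn mdeg1 mul1n addn1 ltnS.
rewrite -(prednK J_gt0) doubleS factS factS -/B mulnA ltn_pmul2r //.
rewrite prednK //; apply: leq_ltn_trans (_ : J.-1.*2.+1 < _)%N.
  by rewrite -ltnS -doubleS prednK // -addnn ltn_add2r (leq_trans _ leJ).
by rewrite ltn_Pmull.
Qed.

End LacunarySeries.

(** * The valuation of the power series field *)

Section LacunaryValuation.
Variables (n m : nat) (k : fieldType) (lt_m : (0 < m)%N) (lt_mn : (m < n)%N).
Hypothesis char0 : [pchar k] =i pred0.

Let x := @lacunary_series n m k lt_m.
Let c : {fps k[n]} -> nat -> {mpoly k[m]} := fps_subst (@mpolyC m k) x.
Let x_0 i : x i 0 = 0. Proof. by []. Qed.
Let c_inj f : f != 0 -> exists N, c f N != 0.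
Proof. exact/fps_subst_inj/lacunary_growing. Qed.
Let c_const a : a != 0 -> c (fpsC n a) 0 != 0.
Proof. by move=> na; rewrite /c fps_subst_coef0 //= eqxx mpolyC_eq0. Qed.

Let i0 : 'I_n := Ordinal (leq_ltn_trans (leq0n m) lt_mn).
(* The index i + 1: ltn_ord i, read as i.+1 <= m, fixes the value of the ordinal. *)
Let iT (i : 'I_m) : 'I_n := Ordinal (leq_ltn_trans (ltn_ord i) lt_mn).

Let cX0 i : c (fpsX k i) 0 = 0. Proof. by rewrite /c fps_substX. Qed.
Let cX1 : c (fpsX k i0) 1 = 1. Proof. by rewrite /c fps_substX. Qed.
Let cXT i : c (fpsX k (iT i)) 1 = 'X_i.
Proof.
rewrite /c fps_substX // /x /lacunary_series /lead_coord /=.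
by rewrite insubT //= => lt_i; congr 'X_(_); apply: val_inj.
Qed.
Let cX1_neq0 : c (fpsX k i0) 1 != 0. Proof. by rewrite cX1 oner_neq0. Qed.
Let c10 : c 1 0 = 1.
Proof. by rewrite /c fps_subst_coef0 //= eqxx mpolyC1. Qed.

Let cD f g N : c (f + g) N = c f N + c g N.
Proof. exact: fps_substD. Qed.
Let cM f g N : c (f * g) N = \sum_(i < N.+1) c f i * c g (N - i).
Proof. exact: fps_substM. Qed.
Let iotaE a : fps_frac_inj n k a = tofrac (fpsC n a).
Proof. by []. Qed.

(** The order in [t] after substituting the lacunary series. *)
Definition lacunary_dval : dvaluation (fps_frac_inj n k) :=
  @ser_dval k {fps k[n]} {mpoly k[m]} (@fpsC n k) (fps_frac_inj n k) c
    iotaE cD cM c_inj c_const (fpsX k i0) (cX0 i0) cX1_neq0.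

Local Notation v := lacunary_dval.

Let res_tofrac f : ser_res c (tofrac f) = tofrac (c f 0).
Proof.
rewrite (ser_res_tofrac iotaE cD cM c_inj c_const (cX0 i0) cX1_neq0).
by rewrite c10 tofrac1 divr1.
Qed.

Lemma lacunary_centered : centered_at_maxideal v.
Proof.
split=> f; first exact: ser_in_vring.
rewrite fps_maxidealP ser_res_in_vmax; last exact: ser_in_vring.
by rewrite res_tofrac tofrac_eq0 /c fps_subst_coef0 // mpolyC_eq0; split=> /eqP.
Qed.

Lemma lacunary_dimension : has_dimension v m.
Proof.
(* The quotients X_(i+1) / X_0 reduce to the variables u_i. *)
pose T i := tofrac (fpsX k (iT i)) / tofrac (fpsX k i0).
have ordX : ser_ord c (fpsX k i0) = 1%N.
  by apply: ser_ord_eq => // i; rewrite ltnS leqn0 => /eqP ->.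
have nX : fpsX k i0 != 0 by apply: contraNneq cX1_neq0 => ->; rewrite ser0.
have VT i : in_vring v (T i).
  by apply/ser_vringP => // j; rewrite ordX ltnS leqn0 => /eqP ->.
apply: (@has_dimension_residue_map _ _ _ v m (ser_res c) T) => //.
- exact: ser_resD.
- exact: ser_resM.
- exact: ser_res_in_vmax.
- move=> a; rewrite iotaE res_tofrac; congr tofrac.
  by rewrite /c fps_subst_coef0 //= eqxx.
move=> i; rewrite (ser_resE nX (VT i)) ordX cX1 cXT tofrac1 divr1 //.
Qed.

End LacunaryValuation.

Theorem theorem4 (k : closedFieldType) (char0 : [pchar k]%R =i pred0)
    (n : nat) (hn : (0 < n)%N) (m : nat) (hm : (1 <= m <= n - 1)%N) :
  exists v : dvaluation (fps_frac_inj n k),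
    centered_at_maxideal v /\ has_dimension v m.
Proof.
have [lt_m le_m] := andP hm.
have lt_mn : (m < n)%N by rewrite -(subnK hn) addn1 ltnS.
exists (lacunary_dval lt_m lt_mn char0).
by split; [exact: lacunary_centered | exact: lacunary_dimension].
Qed.
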